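(* Let $s,t\in\mathbb R$ with $s>t$, and let $\{\vec a_N\}_{N\in\mathbb N}$ be a sequence in $E=(A_\theta^\infty)^re$. Suppose that there is a constant $C$ such that $\|\vec a_N\|_s\le C$ for all $N$. Then there is a subsequence $\{\vec a_{N_j}\}$ that converges in $H^t$.
   Context: Let $n$ be a positive integer and fix a real skew-symmetric $n\times n$ matrix $\theta$ whose entries above the diagonal are irrational and linearly independent over $\mathbb Q$. $A_\theta$ is the universal $C^*$-algebra generated by unitaries $U_1,\dots,U_n$ with $U_kU_j=e^{2\pi i\theta_{j,k}}U_jU_k$. For $m\in\mathbb Z^n$ write $U^m=U_1^{m_1}\cdots U_n^{m_n}$. $\{\alpha_s\}_{s\in\mathbb R^n}$ is the $n$-parameter group of automorphisms of $A_\theta$ with $\alpha_s(U^m)=e^{is\cdot m}U^m$. $A_\theta^\infty$ is the subalgebra of those $a\in A_\theta$ for which $s\mapsto\alpha_s(a)$ is smooth from $\mathbb R^n$ to $A_\theta$; equivalently $a=\sum_m a_mU^m$ with $(a_m)_{m\in\mathbb Z^n}$ rapidly decreasing. $E$ is a finitely generated projective right $A_\theta^\infty$-module, written as a direct summand $E=(A_\theta^\infty)^re$ of the free module $(A_\theta^\infty)^r$, where $e\in M_r(A_\theta^\infty)$ is a self-adjoint idempotent. Elements of $(A_\theta^\infty)^r$ are column vectors on which matrices over $A_\theta^\infty$ act by left multiplication, and $(A_\theta^\infty)^re$ denotes the range of $e$, i.e. $\{\vec a:e\vec a=\vec a\}$. For $s\in\mathbb R$ the Sobolev norm on $E$ is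 $\|\vec a\|_s^2=\sum_{j=1}^r\sum_{m\in\mathbb Z^n}(1+|m_1|^2+\cdots+|m_n|^2)^s|a_{j,m}|^2$, where the components of $\vec a$ are $a_j=\sum_m a_{j,m}U^m$, and $H^s$ is the completion of $E$ with respect to $\|\cdot\|_s$. *)

(* Defs.v *)
From HB Require Import structures.
From mathcomp Require Import all_boot all_order all_algebra.
From mathcomp Require Import complex.
From mathcomp Require Import all_classical all_reals all_analysis.
From mathcomp Require Import showcase.summability.

Set Implicit Arguments.
Unset Strict Implicit.
Unset Printing Implicit Defensive.

Import Order.TTheory GRing.Theory Num.Theory.
Import numFieldNormedType.Exports.

Local Open Scope classical_set_scope.
Local Open Scope complex_scope.
Local Open Scope ring_scope.

(* Unital nonzero C*-algebras over R[i]. They are bundled by hand: Hierarchy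
   Builder has no structure joining rings and normed modules, but the carrier
   can still be given both families of instances. *)
Record cstarAlgType (R : realType) := CStarAlgType {
  cstar_base : completeNormedModType R[i] ;
  cstar_one : cstar_base ;
  cstar_mul : cstar_base -> cstar_base -> cstar_base ;
  cstar_star : cstar_base -> cstar_base ;
  cstar_mulA : associative cstar_mul ;
  cstar_mul1x : left_id cstar_one cstar_mul ;
  cstar_mulx1 : right_id cstar_one cstar_mul ;
  cstar_mulDl : left_distributive cstar_mul +%R ;
  cstar_mulDr : right_distributive cstar_mul +%R ;
  cstar_one_neq0 : cstar_one != 0 ;
  cstar_scaleAl : forall (z : R[i]) x y,
    z *: cstar_mul x y = cstar_mul (z *: x) y ;
  cstar_scaleAr : forall (z : R[i]) x y,
    z *: cstar_mul x y = cstar_mul x (z *: y) ;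
  cstar_starK : involutive cstar_star ;
  cstar_starD : {morph cstar_star : x y / x + y} ;
  cstar_starZ : forall (z : R[i]) x,
    cstar_star (z *: x) = conjc z *: cstar_star x ;
  cstar_starM : forall x y,
    cstar_star (cstar_mul x y) = cstar_mul (cstar_star y) (cstar_star x) ;
  cstar_normM : forall x y, `|cstar_mul x y| <= `|x| * `|y| ;
  cstar_normE : forall x, `|cstar_mul (cstar_star x) x| = `|x| ^+ 2
}.

Definition cstar_sort (R : realType) (A : cstarAlgType R) : Type :=
  cstar_base A.
Coercion cstar_sort : cstarAlgType >-> Sortclass.

Section CStarInstances.
Variables (R : realType) (A : cstarAlgType R).

HB.instance Definition _ :=
  CompleteNormedModule.copy (cstar_sort A) (cstar_base A).
HB.instance Definition _ := GRing.Zmodule_isNzRing.Build (cstar_sort A)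
  (@cstar_mulA R A) (@cstar_mul1x R A) (@cstar_mulx1 R A)
  (@cstar_mulDl R A) (@cstar_mulDr R A) (@cstar_one_neq0 R A).
HB.instance Definition _ := GRing.Lmodule_isLalgebra.Build R[i] (cstar_sort A)
  (@cstar_scaleAl R A).
HB.instance Definition _ := GRing.Lalgebra_isAlgebra.Build R[i] (cstar_sort A)
  (@cstar_scaleAr R A).

End CStarInstances.

Definition star (R : realType) (A : cstarAlgType R) : A -> A :=
  @cstar_star R A.
Arguments star {R A} x.

Definition expi (R : realType) (x : R) : R[i] := cos x +i* sin x.

Section CStar.
Variables (R : realType) (n : nat).

Definition unitary (A : cstarAlgType R) (u : A) : Prop :=
  star u * u = 1 /\ u * star u = 1.

(* The integer powers of a unitary, with star u as inverse. *)
Definition upow (A : cstarAlgType R) (u : A) (k : int) : A :=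
  match k with Posz p => u ^+ p | Negz p => star u ^+ p.+1 end.

(* U^m = U_1^{m_1} ... U_n^{m_n}, in this order. *)
Definition monomial (A : cstarAlgType R) (U : 'I_n -> A) (m : 'rV[int]_n) : A :=
  \prod_(i < n) upow (U i) (m 0 i).

Definition torus_relations (theta : 'M[R]_n) (A : cstarAlgType R)
    (U : 'I_n -> A) : Prop :=
  (forall j, unitary (U j)) /\
  (forall j k, U k * U j = expi (2 * pi * theta j k) *: (U j * U k)).

Definition cstar_generated (A : cstarAlgType R) (U : 'I_n -> A) : Prop :=
  forall S : set A, closed S -> (forall j, S (U j)) -> S 1 ->
    (forall (z : R[i]) x y, S x -> S y -> S (z *: x + y)) ->
    (forall x y, S x -> S y -> S (x * y)) ->
    (forall x, S x -> S (star x)) ->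
    forall x, S x.

(* Uniqueness of the homomorphism in the universal property follows from
   generation. *)
Definition universal_torus (theta : 'M[R]_n) (A : cstarAlgType R)
    (U : 'I_n -> A) : Prop :=
  [/\ torus_relations theta U,
      cstar_generated U &
      forall (B : cstarAlgType R) (V : 'I_n -> B), torus_relations theta V ->
        exists f : {lrmorphism A -> B},
          (forall x, f (star x) = star (f x)) /\ (forall j, f (U j) = V j)].

(* Each alpha s is bijective because alpha (- s) is its inverse. *)
Definition torus_action (A : cstarAlgType R) (U : 'I_n -> A)
    (alpha : 'rV[R]_n -> {lrmorphism A -> A}) : Prop :=
  [/\ (forall s x, alpha s (star x) = star (alpha s x)),
      (forall x, alpha 0 x = x),
      (forall s t x, alpha (s + t) x = alpha s (alpha t x)) &
      (forall s (m : 'rV[int]_n),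
         alpha s (monomial U m) =
           expi (\sum_(i < n) s 0 i * (m 0 i)%:~R) *: monomial U m)].

Definition is_partial (A : cstarAlgType R) (j : 'I_n) (f g : 'rV[R]_n -> A) :
    Prop :=
  forall s, (h^-1)%:C *: (f (s + h *: delta_mx 0 j) - f s) @[h --> 0^'] --> g s.

Fixpoint is_Ck (A : cstarAlgType R) (k : nat) (f : 'rV[R]_n -> A) : Prop :=
  continuous f /\
  match k with
  | 0%N => True
  | k'.+1 => forall j, exists2 g, is_partial j f g & is_Ck k' g
  end.

Definition smooth_elt (A : cstarAlgType R) (alpha : 'rV[R]_n -> A -> A) :
    set A :=
  [set a | forall k, is_Ck k (fun s => alpha s a)].

(* a = \sum_m c_m U^m, unconditionally in norm: the finite partial sums
   converge along the directed set of finite subsets of Z^n. *)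
Definition fourier_expansion (A : cstarAlgType R) (U : 'I_n -> A) (a : A)
    (c : 'rV[int]_n -> R[i]) : Prop :=
  partial_sum (fun m => c m *: monomial U m) @ totally --> a.

(* The a_m of a = \sum_m a_m U^m; the default value is irrelevant for smooth
   elements, which have exactly one expansion. *)
Definition fourier_coef (A : cstarAlgType R) (U : 'I_n -> A) (a : A) :
    'rV[int]_n -> R[i] :=
  xget (fun=> 0) [set c | fourier_expansion U a c].

Section Module.
Variables (A : cstarAlgType R) (U : 'I_n -> A) (r : nat).

Definition smooth_projection (alpha : 'rV[R]_n -> A -> A) (e : 'M[A]_r) :
    Prop :=
  [/\ (forall i j, smooth_elt alpha (e i j)),
      e *m e = e & (map_mx star e)^T = e].

Definition range_module (alpha : 'rV[R]_n -> A -> A) (e : 'M[A]_r) :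
    set 'cV[A]_r :=
  [set a : 'cV[A]_r | (forall j, smooth_elt alpha (a j 0)) /\ e *m a = a].

Definition sobolev_weight (m : 'rV[int]_n) : R :=
  1 + \sum_(i < n) (m 0 i)%:~R ^+ 2.

Definition sobolev_norm (s : R) (a : 'cV[A]_r) : \bar R :=
  ((\sum_(j < r) \esum_(m in [set: 'rV[int]_n])
      (sobolev_weight m `^ s *
         complex.Re (`|fourier_coef U (a j 0) m| ^+ 2))%:E) `^ 2^-1)%E.

(* (H, iota) is a completion of the complex subspace E of A^r for the Sobolev
   norm of order s; iota is only constrained on E. Completions are unique up to
   isometric isomorphism. The C-action on A^r is entrywise: the canonical
   scaling of 'cV[A]_r is by A. *)
Definition sobolev_completion (E : set 'cV[A]_r) (s : R)
    (H : completeNormedModType R[i]) (iota : 'cV[A]_r -> H) : Prop :=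
  [/\ (forall (z : R[i]) a b, E a -> E b ->
         iota (map_mx ( *:%R z) a + b) = z *: iota a + iota b),
      (forall a, E a -> (complex.Re `|iota a|)%:E = sobolev_norm s a) &
      dense (iota @` E)].

End Module.

Definition generic_skew (theta : 'M[R]_n) : Prop :=
  [/\ theta^T = - theta,
      (forall i j : 'I_n, (i < j)%N -> irrational (theta i j)) &
      (forall q : 'I_n -> 'I_n -> rat,
         \sum_(i < n) \sum_(j < n | (i < j)%N) ratr (q i j) * theta i j = 0 ->
         forall i j : 'I_n, (i < j)%N -> q i j = 0)].

End CStar.

(* Main.v *)
Require Import Defs.
From mathcomp Require Import all_boot all_order all_algebra.
From mathcomp Require Import complex.
From mathcomp Require Import all_classical all_reals all_analysis.
From mathcomp Require Import finmap showcase.summability.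
From mathcomp Require Import zify ring lra.
Import Order.TTheory GRing.Theory Num.Theory.
Import numFieldNormedType.Exports.
Local Open Scope classical_set_scope.
Local Open Scope ring_scope.

Set Implicit Arguments.
Unset Strict Implicit.
Unset Printing Implicit Defensive.

(** This is Rellich's compactness theorem: on frequencies of weight at most [L]
    only finitely many Fourier coefficients occur, and on the others the weight
    of order [t] is at most [L^(t-s)] times the weight of order [s], so that the
    tail of an [s]-bounded family is uniformly small for the norm of order [t]
    ([sobolev_sum_tail]). Given a bounded sequence, fix an ultrafilter finer
    than the cofinite filter on the indices: every Fourier coefficient converges
    along it, hence the image of the sequence in [H^t] is a Cauchy filter
    ([sobolev_ultra_cauchy]), and a subsequence follows its limit
    ([ultra_cvg_subsequence]).

    This needs the Fourier coefficients of a difference, that is, the uniqueness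
    of Fourier expansions ([fourier_expansion_uniq]). It rests on the inequality
    [|c_m| <= || sum_k c_k U^k ||] for finite sums ([coef_le_rnorm]): if [m1]
    differs from [m], then for a suitable [sg] in [R^n] the average of [y] and
    of a unimodular multiple of [alpha_sg y] has the same coefficient at [m], no
    component at [m1], and norm at most that of [y]. The norm bound holds
    because a unital star-homomorphism is contractive
    ([starhom_contractive]): a self-adjoint [h] of norm less than 1 is the real
    part of the unitary [h + i sqrt(1 - h^2)] ([selfadj_sqrt]), and a
    star-homomorphism maps unitaries to unitaries.

    The existence of the Fourier expansion of a smooth element is not needed. An
    element without expansion is assigned zero coefficients, which is harmless
    because the Sobolev norm of order [t] is the restriction to [E] of the norm
    of [H^t]. The triangle inequality for [a + k d] and [a - k d], with [k]
    large, shows that if the [j]-th component of [d] has an expansion and that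
    of [a] has none, then the coefficients of the former vanish
    ([hidden_coef]). Consequently the coefficients of [a - b] are always
    dominated by the differences of those of [a] and [b] ([coef_sub_le]). *)

(** * Real-valued norms *)

Section RealNorm.
Context {R : realType} {V : normedModType R[i]}.
Implicit Types x y : V.

(** The norm of a complex normed module as an element of [R]: the norm of
    the structure is a nonnegative element of [R[i]]. *)
Definition rnorm x : R := complex.Re `|x|.

Lemma rnormE x : ((rnorm x)%:C)%C = `|x|.
Proof. exact/RRe_real/normr_real. Qed.

Lemma rnorm_ge0 x : 0 <= rnorm x.
Proof. by rewrite -ler0c rnormE. Qed.

Lemma rnorm0 : rnorm 0 = 0.
Proof. by apply: complexI; rewrite rnormE normr0. Qed.

Lemma rnorm_eq0 x : rnorm x = 0 -> x = 0.
Proof. by move=> x0; apply/normr0_eq0; rewrite -rnormE x0. Qed.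

Lemma rnormN x : rnorm (- x) = rnorm x.
Proof. by rewrite /rnorm normrN. Qed.

Lemma rnormB x y : rnorm (x - y) = rnorm (y - x).
Proof. by rewrite /rnorm distrC. Qed.

Lemma rnormD x y : rnorm (x + y) <= rnorm x + rnorm y.
Proof. by rewrite -lecR rmorphD /= !rnormE ler_normD. Qed.

Lemma rnormZ (z : R[i]) x : rnorm (z *: x) = complex.Re `|z| * rnorm x.
Proof.
by apply: complexI; rewrite rmorphM /= !rnormE normrZ.
Qed.

Lemma rnormZ_ge0 (k : R) x : 0 <= k -> rnorm ((k%:C)%C *: x) = k * rnorm x.
Proof.
move=> k0; rewrite rnormZ; congr (_ * _); apply: complexI.
by rewrite RRe_real ?normr_real// ger0_norm// ler0c.
Qed.

Lemma rnorm_half x : rnorm ((2^-1 : R[i]) *: x) = rnorm x / 2.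
Proof.
have -> : (2^-1 : R[i]) = ((2^-1 : R)%:C)%C by rewrite fmorphV rmorph_nat.
by rewrite rnormZ_ge0 ?invr_ge0// mulrC.
Qed.

Lemma rnorm_le_eps x (K : R) :
  0 < K -> (forall e : R, 0 < e -> e <= 1 -> rnorm x <= K * e) -> x = 0.
Proof.
move=> K0 xe; apply/rnorm_eq0/eqP; rewrite eq_le rnorm_ge0 andbT leNgt.
apply/negP => x0; pose e := Num.min 1 (rnorm x / (K + K)).
have e0 : 0 < e by rewrite lt_min ltr01 divr_gt0 ?addr_gt0.
have := xe e e0; rewrite {1}/e ge_min lexx => /(_ isT).
have : K * e <= rnorm x / 2.
  have -> : rnorm x / 2 = K * (rnorm x / (K + K)).
    by field; rewrite gt_eqF// addr_gt0.
  by rewrite ler_pM2l// ge_min lexx orbT.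
lra.
Qed.

Lemma cvg_rnormP {T : Type} {F : set_system T} {FF : Filter F} (f : T -> V) l :
  f @ F --> l <-> forall e : R, 0 < e -> \forall x \near F, rnorm (l - f x) < e.
Proof.
rewrite cvgrPdist_lt; split => fl e e0.
  have := fl (e%:C)%C; rewrite ltcR => /(_ e0); apply: filterS => x.
  by rewrite -rnormE ltcR.
have eR : e = ((complex.Re e)%:C)%C by rewrite RRe_real// gtr0_real.
move: e0; rewrite eR ltcR => /fl; apply: filterS => x.
by rewrite -rnormE ltcR.
Qed.

End RealNorm.

(** * Contractivity of star-homomorphisms *)

Section CStarNorm.
Context {R : realType} {A : cstarAlgType R}.
Implicit Types x y h u : A.

Lemma rnormM x y : rnorm (x * y) <= rnorm x * rnorm y.
Proof.
rewrite -lecR rmorphM /= !rnormE.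
exact: (@cstar_normM R A x y).
Qed.

Lemma starD x y : star (x + y) = star x + star y.
Proof. exact: (@cstar_starD R A). Qed.

Lemma starZ (z : R[i]) x : star (z *: x) = (conjc z) *: star x.
Proof. exact: cstar_starZ. Qed.

Lemma starK x : star (star x) = x.
Proof. exact: cstar_starK. Qed.

Lemma starM x y : star (x * y) = star y * star x.
Proof. exact: cstar_starM. Qed.

Lemma starN x : star (- x) = - star x.
Proof. by rewrite -scaleN1r starZ rmorphN1 scaleN1r. Qed.

Lemma starB x y : star (x - y) = star x - star y.
Proof. by rewrite starD starN. Qed.

Lemma star0 : star (0 : A) = 0.
Proof. by have := starB 0 0; rewrite !subrr. Qed.

Lemma star1 : star (1 : A) = 1.
Proof. by rewrite -[RHS]starK -[star 1 in RHS]mul1r starM starK mul1r. Qed.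

Lemma rnorm_starM x : rnorm (star x * x) = rnorm x ^+ 2.
Proof.
apply: complexI; rewrite rmorphXn /= !rnormE.
exact: (@cstar_normE R A x).
Qed.

Lemma rnorm_star x : rnorm (star x) = rnorm x.
Proof.
have le y : rnorm y <= rnorm (star y).
  have [->|y0] := eqVneq (rnorm y) 0; first exact: rnorm_ge0.
  have yp : 0 < rnorm y by rewrite lt0r y0 rnorm_ge0.
  by rewrite -(ler_pM2r yp) -expr2 -rnorm_starM rnormM.
by apply/eqP; rewrite eq_le le andbT -{2}(starK x) le.
Qed.

Lemma rnorm1 : rnorm (1 : A) = 1.
Proof.
have n0 : rnorm (1 : A) != 0.
  by apply/eqP => /rnorm_eq0/eqP; rewrite oner_eq0.
by apply: (mulfI n0); rewrite mulr1 -expr2 -rnorm_starM star1 mulr1.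
Qed.

Lemma rnorm_isometry u : star u * u = 1 -> rnorm u = 1.
Proof.
move=> uu; apply/eqP; rewrite -sqrp_eq1 ?rnorm_ge0//.
by rewrite -rnorm_starM uu rnorm1.
Qed.

(** The square root is [k = 1 - y], where [y] is the fixed point of
    [y |-> (h^2 + y^2) / 2], a contraction of the ball of radius [|h|^2] < 1. *)
Lemma selfadj_sqrt h : star h = h -> rnorm h < 1 ->
  exists k, [/\ star k = k, h * k = k * h & h * h + k * k = 1].
Proof.
move=> hs h1; pose g y := (2^-1 : R[i]) *: (h * h + y * y).
pose u := fix u p := if p is q.+1 then g (u q) else 0.
pose c := rnorm h ^+ 2.
have c0 : 0 <= c by rewrite exprn_ge0 ?rnorm_ge0.
have c1 : c < 1 by rewrite /c expr_lt1 ?rnorm_ge0.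
have hc : rnorm (h * h) = c by rewrite /c -rnorm_starM hs.
(* The iterates are self-adjoint, commute with [h], and stay in the ball of
   radius [c]; these properties pass to the limit. *)
have us p : star (u p) = u p.
  elim: p => [|p IH] /=; first exact: star0.
  by rewrite /g starZ starD !starM hs IH fmorphV rmorph_nat.
have uh p : h * u p = u p * h.
  elim: p => [|p IH] /=; first by rewrite mulr0 mul0r.
  rewrite /g -scalerAr -scalerAl; congr (_ *: _).
  by rewrite mulrDr mulrDl !mulrA IH -(mulrA (u p)) IH !mulrA.
have uc p : rnorm (u p) <= c.
  elim: p => [|p IH] /=; first by rewrite rnorm0.
  rewrite /g rnorm_half; have := rnormD (h * h) (u p * u p); rewrite hc => le1.
  have := rnormM (u p) (u p) => le2.
  have := rnorm_ge0 (u p) => ge3; nra.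
have gsub y z : g y - g z = (2^-1 : R[i]) *: (y * (y - z) + (y - z) * z).
  rewrite /g -scalerBr; congr (_ *: _).
  by rewrite mulrBr mulrBl addrA subrK opprD addrACA subrr add0r.
have gle y z (b : R) : rnorm y + rnorm z <= b ->
    rnorm (g y - g z) <= b / 2 * rnorm (y - z).
  move=> yz; rewrite gsub rnorm_half.
  have := rnormD (y * (y - z)) ((y - z) * z).
  have := rnormM y (y - z); have := rnormM (y - z) z.
  have := rnorm_ge0 (y - z); nra.
have uu p k : rnorm (u (p + k)%N - u p) <= c ^+ p.
  elim: p => [|p IH].
    by rewrite subr0 expr0 (le_trans (uc _))// ltW.
  rewrite addSn /= exprS (le_trans (gle _ _ (c + c) _))//.
    by rewrite lerD.
  by rewrite -mulr2n -(mulr_natr c) mulfK ?pnatr_eq0// ler_wpM2l.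
have small (e : R) : 0 < e -> exists N, forall p, (N <= p)%N -> c ^+ p < e.
  move=> e0.
  have /cvgrPdist_lt/(_ e e0)[N _ cN] : (fun p => c ^+ p) @ \oo --> (0 : R).
    by apply: cvg_expr; rewrite ger0_norm.
  exists N => p /cN /=; by rewrite sub0r normrN ger0_norm ?exprn_ge0 ?rnorm_ge0.
have /cvg_ex[y uy] : cvg (u @ \oo).
  apply: cauchy_cvg; apply: cauchy_exP => e e0.
  have eR : e = ((complex.Re e)%:C)%C by rewrite RRe_real// gtr0_real.
  move: e0; rewrite eR ltcR => /small[N cN].
  exists (u N), N => // p /= Np; rewrite -ball_normE /= -rnormE ltcR.
  by rewrite rnormB -(subnKC Np) (le_lt_trans (uu _ _))// cN.
have ye (e : R) : 0 < e -> e <= 1 -> exists p,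
    [/\ rnorm (y - u p) <= e, rnorm (y - u p.+1) <= e & rnorm y <= 2].
  move=> e0 e1; move/cvg_rnormP: uy => /(_ e e0)[N _ yN].
  exists N; have /ltW yN0 := yN N (leqnn _).
  have /ltW yN1 := yN N.+1 (leqnSn _).
  split=> //; rewrite -(subrK (u N) y) (le_trans (rnormD _ _))//.
  have := uc N; move: yN0; lra.
have ys : star y = y.
  apply/eqP; rewrite -subr_eq0; apply/eqP/(@rnorm_le_eps _ _ _ 2) => // e e0 e1.
  have [p [yp _ _]] := ye e e0 e1.
  have -> : star y - y = star (y - u p) - (y - u p).
    by rewrite starB us opprB addrA subrK.
  rewrite (le_trans (rnormD _ _))// rnormN rnorm_star; lra.
have yh : h * y = y * h.
  apply/eqP; rewrite -subr_eq0; apply/eqP/(@rnorm_le_eps _ _ _ 2) => // e e0 e1.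
  have [p [yp _ _]] := ye e e0 e1.
  have -> : h * y - y * h = h * (y - u p) - (y - u p) * h.
    by rewrite mulrBr mulrBl uh opprB addrA subrK.
  rewrite (le_trans (rnormD _ _))// rnormN.
  have := rnormM h (y - u p); have := rnormM (y - u p) h.
  have := rnorm_ge0 h; have := rnorm_ge0 (y - u p); nra.
have yg : y = g y.
  apply/eqP; rewrite -subr_eq0; apply/eqP/(@rnorm_le_eps _ _ _ 4) => // e e0 e1.
  have [p [yp yp1 y2]] := ye e e0 e1.
  have -> : y - g y = (y - u p.+1) - (g y - g (u p)).
    by rewrite opprB addrA subrK.
  rewrite (le_trans (rnormD _ _))// rnormN.
  have := gle y (u p) 3; have := uc p; have := rnorm_ge0 (y - u p).
  move=> ? ?; have y3 : rnorm y + rnorm (u p) <= 3 by lra.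
  move=> /(_ y3); lra.
exists (1 - y); split.
- by rewrite starB star1 ys.
- by rewrite mulrBr mulrBl yh mulr1 mul1r.
have yy : y + y = h * h + y * y.
  have <- : (2 : R[i]) *: g y = h * h + y * y.
    by rewrite /g scalerA divff ?pnatr_eq0// scale1r.
  by rewrite -yg scaler_nat mulr2n.
have -> : (1 - y) * (1 - y) = 1 - (y + y) + y * y.
  by rewrite mulrBr mulr1 mulrBl mul1r opprB opprD !addrA addrAC.
by rewrite yy addrCA subrK.
Qed.

(** It suffices to treat self-adjoint elements, by the C*-identity, and those
    of norm less than 1 are averages of two unitaries. *)
Lemma starhom_contractive (f : {lrmorphism A -> A}) :
  (forall x, f (star x) = star (f x)) -> forall x, rnorm (f x) <= rnorm x.
Proof.
move=> fs.
have small h : star h = h -> rnorm h < 1 -> rnorm (f h) <= 1.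
  move=> hs h1; have [k [ks hk hh]] := selfadj_sqrt hs h1.
  have iJ : conjc ('i%C : R[i]) = - 'i%C.
    by apply/eqP; rewrite eq_complex /= oppr0 !eqxx.
  pose u := h + ('i%C : R[i]) *: k.
  have uE : star u = h - ('i%C : R[i]) *: k.
    by rewrite starD starZ hs ks iJ scaleNr.
  have uu : star u * u = 1.
    rewrite uE mulrBl !mulrDr -!scalerAl -!scalerAr scalerA.
    by rewrite -(expr2 ('i%C : R[i])) sqr_i hk scaleN1r opprD opprK addrA addrK.
  have fu : rnorm (f u) = 1.
    by apply: rnorm_isometry; rewrite -fs -rmorphM /= uu rmorph1.
  have -> : h = (2^-1 : R[i]) *: (u + star u).
    rewrite uE /u addrACA subrr addr0 -mulr2n -(scaler_nat 2 h).
    by rewrite scalerA mulVf ?pnatr_eq0// scale1r.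
  rewrite linearZ linearD /= fs rnorm_half.
  have := rnormD (f u) (star (f u)); rewrite rnorm_star fu.
  lra.
have sa h : star h = h -> rnorm (f h) <= rnorm h.
  move=> hs; apply/ler_addgt0Pr => e e0.
  pose t := rnorm h + e.
  have t0 : 0 < t by rewrite ltr_wpDl ?rnorm_ge0.
  have t1 : 0 <= t^-1 by rewrite invr_ge0 ltW.
  have := small (((t^-1)%:C)%C *: h).
  rewrite starZ hs conjc_real linearZ /= !rnormZ_ge0// => /(_ erefl).
  rewrite ![t^-1 * _]mulrC ltr_pdivrMr// ler_pdivrMr// !mul1r; apply.
  by rewrite ltrDl.
move=> x; rewrite -(@ler_pXn2r _ 2) ?nnegrE ?rnorm_ge0//.
rewrite -!rnorm_starM -fs -rmorphM; apply: sa.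
by rewrite starM starK.
Qed.

End CStarNorm.

(** * Uniqueness of Fourier expansions *)

#[local] Existing Instance totally_filter.

Section Monomials.
Context {R : realType} {n : nat} {A : cstarAlgType R} (U : 'I_n -> A).
Hypothesis unitaryU : forall j, unitary (U j).

Lemma unitary1 : unitary (1 : A).
Proof. by rewrite /unitary star1 mulr1. Qed.

Lemma unitaryM (u v : A) : unitary u -> unitary v -> unitary (u * v).
Proof.
move=> [u1 u2] [v1 v2]; rewrite /unitary starM; split.
- by rewrite mulrA -(mulrA (star v)) u1 mulr1.
- by rewrite mulrA -(mulrA u) v2 mulr1.
Qed.

Lemma unitary_upow (u : A) k : unitary u -> unitary (upow u k).
Proof.
have uX (v : A) p : unitary v -> unitary (v ^+ p).
  move=> vu; elim: p => [|p IH]; first exact: unitary1.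
  by rewrite exprS; apply: unitaryM.
move=> uu; case: k => p; apply: uX => //.
by case: uu => u1 u2; rewrite /unitary starK.
Qed.

Lemma unitary_monomial m : unitary (monomial U m).
Proof.
rewrite /monomial; elim/big_ind: _ => [|u v|i _]; first exact: unitary1.
- exact: unitaryM.
- exact: unitary_upow.
Qed.

Lemma rnorm_monomial m : rnorm (monomial U m) = 1.
Proof. by apply: rnorm_isometry; case: (unitary_monomial m). Qed.

End Monomials.

Section CharacterBound.
Context {R : realType} {n : nat} {A : cstarAlgType R} (U : 'I_n -> A).
Context (alpha : 'rV[R]_n -> {lrmorphism A -> A}).
Hypothesis unitaryU : forall j, unitary (U j).
Hypothesis alphaP : torus_action U alpha.

Lemma expiD (x y : R) : expi (x + y) = expi x * expi y.
Proof.
rewrite /expi cosD sinD; apply/eqP; rewrite eq_complex /=.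
by rewrite eqxx /= addrC [sin x * _]mulrC [cos x * sin y]mulrC mulrC eqxx.
Qed.

Lemma norm_expi (x : R) : `|expi x| = 1.
Proof. by rewrite normc_def /= cos2Dsin2 sqrtr1. Qed.

(** By induction on [s]: each step removes one monomial other than [m0] without
    changing the coefficient at [m0] and without increasing the norm. *)
Lemma coef_le_rnorm (c : 'rV[int]_n -> R[i]) (s : seq 'rV[int]_n) m0 :
  m0 \notin s ->
  complex.Re `|c m0| <=
    rnorm (c m0 *: monomial U m0 + \sum_(m <- s) c m *: monomial U m).
Proof.
elim: s c => [|m1 s IH] c.
  by rewrite big_nil addr0 rnormZ rnorm_monomial// mulr1.
rewrite inE negb_or big_cons => /andP[m01 m0s].
have [j mj] : exists j, m1 0 j != m0 0 j.
  apply/existsP; apply: contraR m01; rewrite negb_exists => /forallP eqm.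
  by apply/eqP/rowP => j; apply/esym/eqP; have := eqm j; rewrite negbK.
(* [w *: alpha sg] fixes [U^m0] and changes the sign of [U^m1], since
   [sg . (m1 - m0) = pi]. *)
pose d : R := (m1 0 j - m0 0 j)%:~R.
have d0 : d != 0 by rewrite intr_eq0 subr_eq0.
pose sg : 'rV[R]_n := (pi / d) *: delta_mx 0 j.
have sgE (m : 'rV[int]_n) :
    \sum_(i < n) sg 0 i * (m 0 i)%:~R = pi / d * (m 0 j)%:~R.
  rewrite (bigD1 j)//= big1 ?addr0 => [|i ij]; last first.
    by rewrite !mxE (negbTE ij) andbF mulr0 mul0r.
  by rewrite !mxE !eqxx mulr1.
pose w := expi (- (pi / d * (m0 0 j)%:~R)).
pose phi (m : 'rV[int]_n) := w * expi (pi / d * (m 0 j)%:~R).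
have phi0 : phi m0 = 1.
  by rewrite /phi /w -expiD addNr /expi cos0 sin0.
have phi1 : phi m1 = -1.
  rewrite /phi /w -expiD addrC -mulrBr -intrB -/d divfK//.
  rewrite /expi cospi sinpi.
  by apply/eqP; rewrite eq_complex /= oppr0 !eqxx.
pose T (y : A) := (2^-1 : R[i]) *: (y + w *: alpha sg y).
case: alphaP => astar _ _ aU.
have Tle y : rnorm (T y) <= rnorm y.
  rewrite /T rnorm_half; have := rnormD y (w *: alpha sg y).
  rewrite rnormZ norm_expi mul1r.
  have := starhom_contractive (astar sg) y; lra.
pose c' (m : 'rV[int]_n) := 2^-1 * (1 + phi m) * c m.
have TD x y : T (x + y) = T x + T y.
  by rewrite /T (raddfD (alpha sg)) [w *: (_ + _)]scalerDr addrACA scalerDr.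
have T0 : T 0 = 0 by rewrite /T linear0 scaler0 addr0 scaler0.
have TU m : T (c m *: monomial U m) = c' m *: monomial U m.
  rewrite /T linearZ /= aU sgE !scalerA -scalerDl scalerA /c' /phi.
  by congr (_ *: _); ring.
have Tsum : T (\sum_(m <- s) c m *: monomial U m) =
    \sum_(m <- s) c' m *: monomial U m.
  by rewrite (big_morph T TD T0); apply: eq_bigr => m _; exact: TU.
have := IH c' m0s.
have {1 2}-> : c' m0 = c m0.
  by rewrite /c' phi0 -mulr2n mulVf ?mul1r// pnatr_eq0.
move=> /le_trans; apply; apply: le_trans (Tle _).
rewrite !TD !TU Tsum.
have -> : c' m0 = c m0.
  by rewrite /c' phi0 -mulr2n mulVf ?mul1r// pnatr_eq0.
have -> : c' m1 = 0 by rewrite /c' phi1 subrr mulr0 mul0r.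
by rewrite scale0r add0r.
Qed.

Lemma fourier_expansion_uniq (x : A) c c' :
  fourier_expansion U x c -> fourier_expansion U x c' -> c = c'.
Proof.
move=> xc xc'; apply/funext => m0; apply/eqP; rewrite -subr_eq0; apply/eqP.
suff : (c m0 - c' m0 : R[i]^o) = 0 by [].
apply/(@rnorm_le_eps _ _ _ 2) => // e e0 _.
move/cvg_rnormP: xc => /(_ e e0)[B1 _ xc].
move/cvg_rnormP: xc' => /(_ e e0)[B2 _ xc'].
(* A finite set that contains [m0] and on which both partial sums are within
   [e] of [x]. *)
pose B := (m0 |` (B1 `|` B2))%fset.
have {}xc : rnorm (x - partial_sum (fun m => c m *: monomial U m) B) < e.
  by apply: xc => /=; rewrite /B fsubsetU// fsubsetUl orbT.
have {}xc' : rnorm (x - partial_sum (fun m => c' m *: monomial U m) B) < e.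
  by apply: xc' => /=; rewrite /B fsubsetU// fsubsetUr orbT.
have psE (b : 'rV[int]_n -> R[i]) :
    partial_sum (fun m => b m *: monomial U m) B =
    b m0 *: monomial U m0 + \sum_(m <- (B `\ m0)%fset) b m *: monomial U m.
  rewrite /partial_sum.
  rewrite -(big_seq_fsetE _ B xpredT (fun m => b m *: monomial U m)) /=.
  by rewrite (big_fsetD1 m0)//= !inE eqxx.
have m0B : m0 \notin (B `\ m0)%fset by rewrite !inE eqxx.
apply: le_trans (coef_le_rnorm (fun m => c m - c' m) m0B) _.
have <- : partial_sum (fun m => c m *: monomial U m) B -
    partial_sum (fun m => c' m *: monomial U m) B =
    (c m0 - c' m0) *: monomial U m0 +
      \sum_(m <- (B `\ m0)%fset) (c m - c' m) *: monomial U m.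
  rewrite !psE opprD addrACA -scalerBl -sumrB; congr (_ + _).
  by apply: eq_bigr => m _; rewrite scalerBl.
set s1 := partial_sum _ _; set s2 := partial_sum _ _ in xc' *.
have -> : s1 - s2 = (x - s2) - (x - s1) by rewrite opprB [RHS]addrC addrA subrK.
have := rnormD (x - s2) (- (x - s1)); rewrite rnormN.
rewrite -/s1 in xc; lra.
Qed.

End CharacterBound.

(** * Fourier coefficients *)

Section FourierCoef.
Context {R : realType} {n : nat} {A : cstarAlgType R} (U : 'I_n -> A).
Context (alpha : 'rV[R]_n -> {lrmorphism A -> A}).
Hypothesis unitaryU : forall j, unitary (U j).
Hypothesis alphaP : torus_action U alpha.
Local Notation coef := (fourier_coef U).

(** The elements that have a Fourier expansion. *)
Definition expandable : set A := [set x | exists c, fourier_expansion U x c].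

Lemma fourier_expansion_lin (z : R[i]) x y c d :
  fourier_expansion U x c -> fourier_expansion U y d ->
  fourier_expansion U (z *: x + y) (fun m => z * c m + d m).
Proof.
move=> xc yd; rewrite /fourier_expansion.
have -> : partial_sum (fun m => (z * c m + d m) *: monomial U m) =
    fun B => z *: partial_sum (fun m => c m *: monomial U m) B +
             partial_sum (fun m => d m *: monomial U m) B.
  apply/funext => B; rewrite /partial_sum scaler_sumr -big_split /=.
  by apply: eq_bigr => m _; rewrite scalerDl scalerA.
by apply: cvgD yd; exact: cvgZr xc.
Qed.

Lemma expandable_lin (z : R[i]) x y :
  expandable x -> expandable y -> expandable (z *: x + y).
Proof.
by move=> [c xc] [d yd]; eexists; exact: fourier_expansion_lin xc yd.
Qed.

Lemma fourier_expansion0 : fourier_expansion U 0 (fun=> 0).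
Proof.
rewrite /fourier_expansion.
have -> : partial_sum (fun m => (0 : R[i]) *: monomial U m) = cst 0.
  by apply/funext => B; rewrite /partial_sum big1// => i _; rewrite scale0r.
exact: cvg_cst.
Qed.

Lemma expandable0 : expandable 0.
Proof. by exists (fun=> 0); exact: fourier_expansion0. Qed.

Lemma expandableZ (z : R[i]) x : expandable x -> expandable (z *: x).
Proof. by move=> /(expandable_lin z)/(_ expandable0); rewrite addr0. Qed.

Lemma expandableB x y : expandable x -> expandable y -> expandable (x - y).
Proof.
by move=> xD /(expandable_lin (-1))/(_ xD); rewrite scaleN1r addrC.
Qed.

Lemma fourier_coefE x c : fourier_expansion U x c -> coef x = c.
Proof.
move=> xc; apply: (fourier_expansion_uniq unitaryU alphaP (x := x)) => //.
exact: (xgetPex (fun=> 0) (ex_intro _ c xc)).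
Qed.

(** The default value of [fourier_coef] matters here: it is zero. *)
Lemma fourier_coef_nexp x : ~ expandable x -> coef x = fun=> 0.
Proof. by move=> nx; apply: xgetPN => c xc; apply: nx; exists c. Qed.

Lemma fourier_coef_lin (z : R[i]) x y : expandable x -> expandable y ->
  coef (z *: x + y) = fun m => z * coef x m + coef y m.
Proof.
move=> [c xc] [d yd].
rewrite (fourier_coefE xc) (fourier_coefE yd).
exact/fourier_coefE/fourier_expansion_lin.
Qed.

Lemma fourier_coefZ (z : R[i]) x : expandable x ->
  coef (z *: x) = fun m => z * coef x m.
Proof.
move=> xD; rewrite -[z *: x]addr0 (fourier_coef_lin z xD expandable0).
by apply/funext => m; rewrite (fourier_coefE fourier_expansion0) addr0.
Qed.

Lemma fourier_coefB x y : expandable x -> expandable y ->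
  coef (x - y) = fun m => coef x m - coef y m.
Proof.
move=> xD yD; rewrite addrC -scaleN1r (fourier_coef_lin _ yD xD).
by apply/funext => m; rewrite mulN1r addrC.
Qed.

(** Two expandable elements of the line [x + C y] would make [y] expandable. *)
Lemma near_nexpandable (u : nat -> R[i]) x y : injective u -> ~ expandable y ->
  \forall k \near \oo, ~ expandable (u k *: y + x).
Proof.
move=> uI ny.
have [[k0 k0D]|nD] := pselect (exists k, expandable (u k *: y + x)).
  exists k0.+1 => // k /= k0k kD; apply: ny.
  have ukk0 : u k - u k0 != 0.
    by rewrite subr_eq0; apply/eqP => /uI kE; rewrite kE ltnn in k0k.
  have := expandableZ (u k - u k0)^-1 (expandableB kD k0D).
  by rewrite opprD addrACA subrr addr0 -scalerBl scalerA mulVf// scale1r.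
by exists 0%N => // k _ kD; apply: nD; exists k.
Qed.

End FourierCoef.

(** * The module of smooth vectors *)

Section SmoothModule.
Context {R : realType} {n : nat} {A : cstarAlgType R}.
Implicit Types f g : 'rV[R]_n -> A.

Lemma is_Ck_lin (z : R[i]) k f g : is_Ck k f -> is_Ck k g ->
  is_Ck k (fun s => z *: f s + g s).
Proof.
have contD f' g' : continuous f' -> continuous g' ->
    continuous (fun s : 'rV[R]_n => z *: f' s + g' s : A).
  by move=> cf cg s; apply: cvgD (cg s); apply: cvgZr (cf s).
elim: k f g => [|k IH] f g [cf df] [cg dg]; split; try exact: contD.
  by [].
move=> j; have [f' ff' cf'] := df j; have [g' gg' cg'] := dg j.
exists (fun s => z *: f' s + g' s); last exact: IH.
move=> s; have -> : (fun h : R => ((h^-1)%:C)%C *: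
      (z *: f (s + h *: delta_mx 0 j) +
      g (s + h *: delta_mx 0 j) - (z *: f s + g s))) =
    fun h => z *: (((h^-1)%:C)%C *: (f (s + h *: delta_mx 0 j) - f s)) +
             ((h^-1)%:C)%C *: (g (s + h *: delta_mx 0 j) - g s).
  apply/funext => h; rewrite scalerA mulrC -scalerA -scalerDr; congr (_ *: _).
  by rewrite scalerBr opprD addrACA.
by apply: cvgD (gg' s); apply: cvgZr (ff' s).
Qed.

Context (alpha : 'rV[R]_n -> {lrmorphism A -> A}) (r : nat) (e : 'M[A]_r).

Lemma smooth_elt_lin (z : R[i]) x y :
  smooth_elt alpha x -> smooth_elt alpha y ->
  smooth_elt alpha (z *: x + y).
Proof.
move=> xS yS k; have := is_Ck_lin z (xS k) (yS k).
by congr (is_Ck k _); apply/funext => s; rewrite linearP.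
Qed.

Lemma range_module_lin (z : R[i]) (a b : 'cV[A]_r) :
  range_module alpha e a -> range_module alpha e b ->
  range_module alpha e (map_mx ( *:%R z) a + b).
Proof.
move=> [aS ea] [bS eb]; split.
  by move=> j; rewrite !mxE; apply: smooth_elt_lin.
rewrite mulmxDr eb; congr (_ + _); rewrite -[in RHS]ea.
apply/matrixP => i j; rewrite !mxE scaler_sumr; apply: eq_bigr => k _.
by rewrite !mxE scalerAr.
Qed.

Lemma map_mxN1D (a b : 'cV[A]_r) : map_mx ( *:%R (-1 : R[i])) b + a = a - b.
Proof. by apply/matrixP => i j; rewrite !mxE scaleN1r addrC. Qed.

Lemma range_moduleB (a b : 'cV[A]_r) :
  range_module alpha e a -> range_module alpha e b ->
  range_module alpha e (a - b).
Proof. by move=> aE bE; rewrite -map_mxN1D; exact: range_module_lin. Qed.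

End SmoothModule.

(** * Weighted sums of squares *)

Section SobolevSum.
Context {R : realType} {n : nat}.
Implicit Types (c d : 'rV[int]_n -> R[i]) (m : 'rV[int]_n) (z w : R[i]).

(** The squared modulus of a complex number, as an element of [R]. *)
Definition sqnorm z : R := complex.Re (`|z| ^+ 2).

Lemma sqnormE z : sqnorm z = complex.Re z ^+ 2 + complex.Im z ^+ 2.
Proof. by rewrite /sqnorm -add_Re2_Im2. Qed.

Lemma sqnorm_ge0 z : 0 <= sqnorm z.
Proof. by rewrite sqnormE addr_ge0// sqr_ge0. Qed.

Lemma sqnorm0 : sqnorm 0 = 0.
Proof. by rewrite sqnormE /= expr0n addr0. Qed.

Lemma sqnorm_eq0 z : sqnorm z = 0 -> z = 0.
Proof.
rewrite sqnormE => /eqP; rewrite paddr_eq0 ?sqr_ge0// !sqrf_eq0 => /andP[zr zi].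
by apply/eqP; rewrite eq_complex zr.
Qed.

Lemma sqnormN z : sqnorm (- z) = sqnorm z.
Proof. by rewrite /sqnorm normrN. Qed.

Lemma sqnorm_parallelogram z w :
  sqnorm (z + w) + sqnorm (- z + w) = 2 * (sqnorm z + sqnorm w).
Proof. by rewrite !sqnormE; case: z => a b; case: w => a' b' /=; ring. Qed.

Lemma sqnormD_le z w : sqnorm (z + w) <= 2 * (sqnorm z + sqnorm w).
Proof. by rewrite -sqnorm_parallelogram lerDl sqnorm_ge0. Qed.

Lemma sqnorm_natM (k : nat) z : sqnorm (k%:R * z) = k%:R ^+ 2 * sqnorm z.
Proof.
have -> : (k%:R : R[i]) = ((k%:R)%:C)%C by rewrite rmorph_nat.
by rewrite !sqnormE; case: z => a b /=; ring.
Qed.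

Lemma sobolev_weight_ge1 m : 1 <= sobolev_weight R m.
Proof. by rewrite /sobolev_weight lerDl sumr_ge0// => i _; exact: sqr_ge0. Qed.

Lemma sobolev_weight_powR_gt0 m (s : R) : 0 < sobolev_weight R m `^ s.
Proof. by rewrite powR_gt0// (lt_le_trans ltr01)// sobolev_weight_ge1. Qed.

Lemma finite_sobolev_weight_le (L : R) :
  finite_set [set m : 'rV[int]_n | sobolev_weight R m <= L].
Proof.
have [K LK] : exists K : nat, L <= K%:R.
  exists (Num.bound `|L|); rewrite (le_trans (ler_norm _))// ltW//.
  exact: archi_boundP.
(* The entries of [m] lie in [-K, K], so [m] is the image of a vector of
   ordinals. *)
pose g (M : 'rV['I_(K + K).+1]_n) : 'rV[int]_n :=
  map_mx (fun i : 'I_(K + K).+1 => (i : nat)%:Z - K%:Z) M.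
apply: (sub_finite_set (B := range g)); last first.
  exact/finite_image/finite_finset.
move=> m /= mL.
have mK (j : 'I_n) : (`|(m 0 j)%R|%N <= K)%N.
  rewrite -(ler_nat R); apply: le_trans LK; apply: le_trans mL.
  have sqmj : (`|(m 0 j)%R|%N)%:R <= ((m 0 j)%:~R : R) ^+ 2.
    rewrite pmulrn -rmorphXn /= ler_int expr2; nia.
  rewrite (le_trans sqmj)// /sobolev_weight (bigD1 j)//= addrCA lerDl.
  by rewrite addr_ge0// sumr_ge0// => i _; exact: sqr_ge0.
have mS (j : 'I_n) : (`|(m 0 j + K%:Z)%R|%N < (K + K).+1)%N.
  by have := mK j; lia.
exists (\row_j Ordinal (mS j)) => //.
by apply/rowP => j; rewrite !mxE /=; have := mK j; lia.
Qed.

(** The squared Sobolev norm of order [s] of a family of coefficients. *)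
Definition sobolev_sum (s : R) c : \bar R :=
  \esum_(m in [set: 'rV[int]_n]) (sobolev_weight R m `^ s * sqnorm (c m))%:E.

Lemma sobolev_term_ge0 s m z :
  (0 <= (sobolev_weight R m `^ s * sqnorm z)%:E)%E.
Proof. by rewrite lee_fin mulr_ge0 ?powR_ge0 ?sqnorm_ge0. Qed.

Lemma sobolev_sum_ge0 s c : (0 <= sobolev_sum s c)%E.
Proof. by apply: esum_ge0 => m _; exact: sobolev_term_ge0. Qed.

Lemma sobolev_term_le s c m :
  ((sobolev_weight R m `^ s * sqnorm (c m))%:E <= sobolev_sum s c)%E.
Proof.
apply: esum_ge; exists [set m]; first by split=> //; exact: finite_set1.
by rewrite fsbig_set1.
Qed.

Lemma le_sobolev_sum s c d : (forall m, sqnorm (c m) <= sqnorm (d m)) ->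
  (sobolev_sum s c <= sobolev_sum s d)%E.
Proof.
move=> cd; apply: le_esum => m _.
by rewrite lee_fin ler_wpM2l ?powR_ge0.
Qed.

Lemma sobolev_sum0 s : sobolev_sum s (fun=> 0) = 0%E.
Proof. by apply: esum1 => m _; rewrite sqnorm0 mulr0. Qed.

Lemma esumZ_le (I : choiceType) (f : I -> \bar R) (k : R) : 0 <= k ->
  (forall i, 0 <= f i)%E ->
  (\esum_(i in [set: I]) (k%:E * f i) <= k%:E * \esum_(i in [set: I]) f i)%E.
Proof.
move=> k0 f0; apply: ge_ereal_sup => _ [X [finX _]] <-.
rewrite -ge0_mule_fsumr//; apply: lee_wpmul2l; first by rewrite lee_fin.
by apply: esum_ge; exists X.
Qed.

Lemma sobolev_sum_parallelogram s c d :
  (sobolev_sum s (fun m => c m + d m)%R +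
     sobolev_sum s (fun m => - c m + d m)%R <=
  2%:E * (sobolev_sum s c + sobolev_sum s d))%E.
Proof.
rewrite /sobolev_sum -!esumD; try by move=> *; exact: sobolev_term_ge0.
apply: le_trans (esumZ_le _ _) => //; last first.
  by move=> m; rewrite adde_ge0// sobolev_term_ge0.
apply: le_esum => m _; rewrite -!EFinD -EFinM lee_fin -!mulrDr.
by rewrite sqnorm_parallelogram mulrCA.
Qed.

(** If the coefficients of [c] and [d] are close on the finitely many
    frequencies of weight at most [L], their distance for the norm of order [t]
    is controlled by their norms of order [s]: on the other frequencies, the
    weight of order [t] is at most [L^(t-s)] times that of order [s]. *)
Lemma sobolev_sum_tail (s t : R) (L del K : R) c d :
  t < s -> 0 < L -> 0 <= del -> 
  (forall m, sobolev_weight R m <= L ->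
     sobolev_weight R m `^ t * sqnorm (c m - d m) <= del) ->
  (sobolev_sum s c <= K%:E)%E -> (sobolev_sum s d <= K%:E)%E ->
  (sobolev_sum t (fun m => c m - d m)%R <=
   (del * (#|` fset_set [set m : 'rV[int]_n | sobolev_weight R m <= L]|)%fset%:R
    + 4 * K * L `^ (t - s))%:E)%E.
Proof.
move=> ts L0 del0 cdel cK dK.
set S := [set m | _].
have finS : finite_set S := finite_sobolev_weight_le L.
pose f m : \bar R := if m \in S then del%:E else 0%E.
pose g m : \bar R := (sobolev_weight R m `^ s * sqnorm (c m))%:E +
  (sobolev_weight R m `^ s * sqnorm (d m))%:E.
have f0 m : (0 <= f m)%E by rewrite /f; case: ifP.
have g0 m : (0 <= g m)%E by rewrite adde_ge0// sobolev_term_ge0.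
(* [f] dominates the terms of weight at most [L], and [k g] the other ones. *)
pose k := 2 * L `^ (t - s).
have k0 : 0 <= k by rewrite mulr_ge0// powR_ge0.
have fgle : (sobolev_sum t (fun m => c m - d m)%R <=
    \esum_(m in [set: 'rV[int]_n]) (f m + k%:E * g m))%E.
  apply: le_esum => m _; rewrite /f; case: ifPn => mS.
    apply: (@le_trans _ _ del%:E); last by rewrite leeDl// mule_ge0.
    by rewrite lee_fin; apply: cdel; exact: set_mem mS.
  rewrite add0e /g -EFinD -EFinM lee_fin -mulrDr.
  have Lm : L <= sobolev_weight R m.
    by rewrite leNgt; apply: contra mS => /ltW mL; exact: mem_set.
  have w0 : 0 < sobolev_weight R m by exact: lt_le_trans Lm.
  have wts : sobolev_weight R m `^ t <= L `^ (t - s) * sobolev_weight R m `^ s.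
    have -> : sobolev_weight R m `^ t =
        sobolev_weight R m `^ (t - s) * sobolev_weight R m `^ s.
      by rewrite -powRD ?subrK// (gt_eqF w0) implybT.
    rewrite ler_wpM2r ?powR_ge0// -[t - s]opprB !powRN.
    rewrite lef_pV2 ?posrE ?powR_gt0//.
    by apply: ge0_ler_powR => //; rewrite ?subr_ge0 ?nnegrE ltW.
  have := sqnormD_le (c m) (- d m); rewrite sqnormN => cd.
  apply: le_trans (ler_pM _ _ wts cd) _; rewrite ?powR_ge0 ?sqnorm_ge0//.
  by rewrite /k le_eqVlt; apply/orP; left; apply/eqP; ring.
apply: le_trans fgle _.
rewrite esumD//; last by move=> m _; rewrite mule_ge0.
rewrite EFinD; apply: leeD.
  rewrite -esum_mkcond esum_fset// fsbig_finite//=.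
  rewrite sumEFin lee_fin big_const_seq count_predT iter_addr addr0 mulr_natr.
  by rewrite lexx.
apply: le_trans (esumZ_le _ _) _ => //.
rewrite esumD; try by move=> *; exact: sobolev_term_ge0.
apply: (@le_trans _ _ (k%:E * (K%:E + K%:E))%E).
  by apply: lee_wpmul2l; [rewrite lee_fin|exact: leeD].
by rewrite -EFinD -EFinM lee_fin /k le_eqVlt; apply/orP; left; apply/eqP; ring.
Qed.

End SobolevSum.

(** * Coefficients of differences *)

(** With [P], [M], [N], [D] the norms of [a + d], [a - d], [a] and [d], and with
    [qp], [qm], [qa], [qd] the squared norms of their components: if every
    component satisfies the parallelogram inequality, and the [j]-th components
    of [a + d] and [a - d] are seen as zero by the norm, then the triangle
    inequality bounds the [j]-th component of [d] by the norm of [a]. *)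
Lemma parallelogram_defect {R : realType} (I : finType) (j : I)
    (qp qm qa qd : I -> R) (P M N D : R) :
  0 <= P -> 0 <= M -> 0 <= D -> 0 <= qa j ->
  \sum_i qp i = P ^+ 2 -> \sum_i qm i = M ^+ 2 ->
  \sum_i qa i = N ^+ 2 -> \sum_i qd i = D ^+ 2 ->
  (forall i, qp i + qm i <= 2 * (qa i + qd i)) ->
  qp j = 0 -> qm j = 0 -> 2 * D <= P + M ->
  qd j <= N ^+ 2.
Proof.
move=> P0 M0 D0 qaj sp sm sa sd para pj mj DPM.
have DPM2 : (2 * D) ^+ 2 <= (P + M) ^+ 2.
  by rewrite ler_pXn2r// nnegrE ?mulr_ge0 ?addr_ge0.
have PM0 := sqr_ge0 (P - M).
have : \sum_(i | i != j) (qp i + qm i) <= \sum_(i | i != j) 2 * (qa i + qd i).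
  by apply: ler_sum.
rewrite -mulr_sumr !big_split /=.
move: sp sm sa sd; rewrite !(bigD1 j (P := xpredT))//= pj mj.
rewrite !expr2 in DPM2 PM0 *; nra.
Qed.

Section Completion.
Context {R : realType} {n : nat} {A : cstarAlgType R} (U : 'I_n -> A).
Context (alpha : 'rV[R]_n -> {lrmorphism A -> A}).
Hypothesis unitaryU : forall j, unitary (U j).
Hypothesis alphaP : torus_action U alpha.
Context (r : nat) (e : 'M[A]_r).
Local Notation coef := (fourier_coef U).
Local Notation E := (range_module alpha e).
Implicit Types a b d : 'cV[A]_r.

Lemma sobolev_norm_sqr (s p : R) a : 0 <= p -> sobolev_norm U s a = p%:E ->
  (\sum_(j < r) sobolev_sum s (coef (a j 0%R)) = (p ^+ 2)%:E)%E.
Proof.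
move=> p0; rewrite /sobolev_norm poweR12_sqrt; last first.
  by apply: sume_ge0 => j _; exact: sobolev_sum_ge0.
move=> pE; rewrite -[LHS]sqr_sqrte; last first.
  by apply: sume_ge0 => j _; exact: sobolev_sum_ge0.
by rewrite -/(sobolev_sum _ _) pE EFin_expe.
Qed.

Lemma sobolev_norm_le (s C : R) a j : (sobolev_norm U s a <= C%:E)%E ->
  (sobolev_sum s (coef (a j 0%R)) <= (C ^+ 2)%:E)%E.
Proof.
move=> aC; have a0 : (0 <= sobolev_norm U s a)%E by exact: poweR_ge0.
have : sobolev_norm U s a \is a fin_num.
  by rewrite ge0_fin_numE// (le_lt_trans aC)// ltry.
move=> /fineK nE; have p0 := fine_ge0 a0.
have pC : fine (sobolev_norm U s a) <= C by rewrite -lee_fin nE.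
have := sobolev_norm_sqr p0 (esym nE); rewrite (bigD1 j)//= => sE.
apply: (@le_trans _ _ (fine (sobolev_norm U s a) ^+ 2)%:E).
  by rewrite -sE leeDl// sume_ge0// => i _; exact: sobolev_sum_ge0.
by rewrite lee_fin ler_pXn2r// nnegrE// (le_trans p0).
Qed.

Context (t : R) (Ht : completeNormedModType R[i]) (iota : 'cV[A]_r -> Ht).
Hypothesis HtP : sobolev_completion U E t iota.

Let combE (z : R[i]) a b j : (map_mx ( *:%R z) a + b) j 0 = z *: a j 0 + b j 0.
Proof. by rewrite !mxE. Qed.

Let iotaE (z : R[i]) a b : E a -> E b ->
  iota (map_mx ( *:%R z) a + b) = z *: iota a + iota b.
Proof. by case: HtP => + _ _; exact. Qed.

Let iotaB a b : E a -> E b -> iota (a - b) = iota a - iota b.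
Proof. by move=> aE bE; rewrite -map_mxN1D iotaE// scaleN1r addrC. Qed.

Let sumE a : E a ->
  (\sum_(j < r) sobolev_sum t (coef (a j 0%R)) = (rnorm (iota a) ^+ 2)%:E)%E.
Proof.
move=> aE; case: HtP => _ /(_ a aE) aN _.
by apply: sobolev_norm_sqr; rewrite ?rnorm_ge0.
Qed.

Let sum_fin a j : E a -> sobolev_sum t (coef (a j 0)) \is a fin_num.
Proof.
move=> aE; rewrite ge0_fin_numE ?sobolev_sum_ge0//.
apply: le_lt_trans (ltry (rnorm (iota a) ^+ 2)).
rewrite -sumE// (bigD1 j)//= leeDl// sume_ge0// => i _; exact: sobolev_sum_ge0.
Qed.

(** The squared norm of order [t] of the [j]-th component of [a]. *)
Let q a j := fine (sobolev_sum t (coef (a j 0))).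

Let q_ge0 a j : 0 <= q a j.
Proof. exact/fine_ge0/sobolev_sum_ge0. Qed.

Let sum_q a : E a -> \sum_(j < r) q a j = rnorm (iota a) ^+ 2.
Proof.
move=> aE; apply: EFin_inj; rewrite -sumE// -sumEFin; apply: eq_bigr => j _.
by rewrite fineK ?sum_fin.
Qed.

Let qE a j : E a -> sobolev_sum t (coef (a j 0)) = (q a j)%:E.
Proof. by move=> aE; rewrite fineK ?sum_fin. Qed.

(** For [k] large, [a] and [k d] satisfy the parallelogram inequality in each
    component: in a component where [d] is not expandable, or where it is
    and [a] is not, [a + k d] and [a - k d] are not expandable and have
    zero coefficients. Their [j]-th components are never expandable. By
    [parallelogram_defect], [k^2] times the weighted squared coefficients of the
    [j]-th component of [d] are then bounded by the squared norm of [a]. *)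
Lemma hidden_coef a d j : E a -> E d ->
  ~ expandable U (a j 0) -> expandable U (d j 0) ->
  forall m, coef (d j 0) m = 0.
Proof.
move=> aE dE naj dj m.
have E0 : E 0 by rewrite -(subrr d); exact: range_moduleB.
pose ap (k : nat) := map_mx ( *:%R k%:R) d + a.
pose am (k : nat) := map_mx ( *:%R (- k%:R)) d + a.
pose kd (k : nat) := map_mx ( *:%R k%:R) d + 0.
have apE k : E (ap k) by exact: range_module_lin.
have amE k : E (am k) by exact: range_module_lin.
have kdE k : E (kd k) by exact: range_module_lin.
have kdj k i : kd k i 0 = k%:R *: d i 0 by rewrite combE mxE addr0.
have q0 b i : ~ expandable U (b i 0) -> q b i = 0.
  by move=> nb; rewrite /q fourier_coef_nexp// sobolev_sum0.
have nexp (z : R[i]) i : ~ expandable U (a i 0) -> expandable U (d i 0) ->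
    ~ expandable U (z *: d i 0 + a i 0).
  move=> nai di zx; apply: nai.
  have := expandable_lin 1 zx (expandableZ (- z) di).
  by rewrite scale1r scaleNr addrC addKr.
(* parallelogram inequality of each component, for large k *)
have para : \forall k \near \oo, forall i : 'I_r,
    q (ap k) i + q (am k) i <= 2 * (q a i + q (kd k) i).
  apply: filter_forall => i.
  have [di|ndi] := pselect (expandable U (d i 0)); last first.
    have nI : injective (fun k : nat => k%:R : R[i]).
      by move=> k l /eqP; rewrite eqr_nat => /eqP.
    have mI : injective (fun k : nat => - k%:R : R[i]).
      by move=> k l /oppr_inj/nI.
    near=> k.
    have -> : q (ap k) i = 0.
      by apply: q0; rewrite combE; near: k; exact: near_nexpandable nI ndi.
    have -> : q (am k) i = 0.
      by apply: q0; rewrite combE; near: k; exact: near_nexpandable mI ndi.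
    by rewrite add0r mulr_ge0// addr_ge0.
  apply: nearW => k.
  have [ai|nai] := pselect (expandable U (a i 0)); last first.
    rewrite (q0 (ap k)) ?(q0 (am k)) ?combE; try exact: nexp.
    by rewrite add0r mulr_ge0// addr_ge0.
  suff : (sobolev_sum t (coef (ap k i 0%R)) +
          sobolev_sum t (coef (am k i 0%R)) <=
      2%:E * (sobolev_sum t (coef (a i 0%R)) +
              sobolev_sum t (coef (kd k i 0%R))))%E.
    by rewrite !qE// -!EFinD -EFinM lee_fin.
  rewrite kdj !combE.
  rewrite !(fourier_coef_lin unitaryU alphaP)//.
  rewrite (fourier_coefZ unitaryU alphaP)//.
  under [X in (_ + sobolev_sum _ X <= _)%E]eq_fun do rewrite mulNr.
  by rewrite [X in (_ <= _ * X)%E]addeC sobolev_sum_parallelogram.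
have qj k : q (ap k) j = 0 /\ q (am k) j = 0.
  by split; apply: q0; rewrite combE; exact: nexp.
have iota0 : iota 0 = 0 by rewrite -(subrr d) iotaB// subrr.
(* A bound independent of [k], while the left-hand side grows like [k^2]. *)
have bound : \forall k \near \oo, q (kd k) j <= rnorm (iota a) ^+ 2.
  near=> k.
  have kpara : forall i, q (ap k) i + q (am k) i <= 2 * (q a i + q (kd k) i).
    by near: k.
  have [apj amj] := qj k.
  apply: (parallelogram_defect (rnorm_ge0 _) (rnorm_ge0 _) (rnorm_ge0 _)
    (q_ge0 a j) (sum_q (apE k)) (sum_q (amE k)) (sum_q aE) (sum_q (kdE k)) kpara
    apj amj).
  have -> : 2 * rnorm (iota (kd k)) = rnorm (2%:R *: iota (kd k)).
    have -> : (2%:R : R[i]) = ((2%:R)%:C)%C by rewrite rmorph_nat.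
    by rewrite rnormZ_ge0.
  have -> : 2%:R *: iota (kd k) = iota (ap k) - iota (am k).
    rewrite !iotaE// iota0 addr0 opprD addrACA subrr addr0 scaleNr opprK.
    by rewrite -mulr2n scaler_nat.
  by rewrite -[rnorm (iota (am k))]rnormN; exact: rnormD.
apply: sqnorm_eq0; apply/eqP; rewrite eq_le sqnorm_ge0 andbT leNgt.
apply/negP => x0.
pose x := sobolev_weight R m `^ t * sqnorm (coef (d j 0) m).
have {}x0 : 0 < x by rewrite mulr_gt0 ?sobolev_weight_powR_gt0.
have kx : \forall k \near \oo, rnorm (iota a) ^+ 2 < k%:R * x.
  have := nbhs_infty_gtr (rnorm (iota a) ^+ 2 / x); apply: filterS => k.
  by rewrite ltr_pdivrMr.
have [k [[qk k0] {}kx]] :=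
  filter_ex (filterI (filterI bound (nbhs_infty_gt 0)) kx).
have k1 : k%:R * x <= k%:R ^+ 2 * x.
  by rewrite ler_pM2r// ler_eXnr// ler1n.
have : k%:R ^+ 2 * x <= q (kd k) j.
  rewrite -lee_fin -qE// kdj (fourier_coefZ unitaryU alphaP)//.
  apply: le_trans (sobolev_term_le _ _ m); rewrite lee_fin sqnorm_natM.
  by rewrite /x mulrCA.
lra.
Unshelve. all: by end_near.
Qed.

(** If exactly one of the two components is expandable, their difference is not,
    and its coefficients are zero; if neither is, and the difference is, the
    coefficients of the difference are zero by [hidden_coef]. *)
Lemma coef_sub_le a b j m : E a -> E b ->
  sqnorm (coef ((a - b) j 0) m) <= sqnorm (coef (a j 0) m - coef (b j 0) m).
Proof.
move=> aE bE; rewrite !mxE.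
have [aj|naj] := pselect (expandable U (a j 0)).
  have [bj|nbj] := pselect (expandable U (b j 0)).
    by rewrite (fourier_coefB unitaryU alphaP).
  rewrite fourier_coef_nexp ?sqnorm0 ?sqnorm_ge0// => abj; apply: nbj.
  by have := expandableB aj abj; rewrite opprB addrC subrK.
have [abj|nabj] := pselect (expandable U (a j 0 - b j 0)); last first.
  by rewrite fourier_coef_nexp ?sqnorm0 ?sqnorm_ge0.
have := hidden_coef aE (range_moduleB aE bE) naj.
by rewrite !mxE => ->//; rewrite sqnorm0 sqnorm_ge0.
Qed.

Lemma rnorm_iota_sub_sqr a b : E a -> E b ->
  ((rnorm (iota a - iota b) ^+ 2)%:E <= \sum_(j < r)
     sobolev_sum t (fun m => coef (a j 0) m - coef (b j 0) m)%R)%E.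
Proof.
move=> aE bE; rewrite -iotaB// -sumE; last exact: range_moduleB.
by apply: lee_sum => j _; apply: le_sobolev_sum => m; exact: coef_sub_le.
Qed.

End Completion.

(** * Convergence along an ultrafilter *)

Lemma ultra_fmap {T S : Type} (F : set_system T) (f : T -> S) :
  UltraFilter F -> UltraFilter (f @ F).
Proof.
move=> FU; split; first exact: fmap_proper_filter.
move=> G GP FG; apply/seteqP; split; last exact: FG.
move=> B GB; have [//|FnB] := in_ultra_setVsetC (f @^-1` B) FU.
by have [x []] := filter_ex (filterI GB (FG (~` B) FnB)).
Qed.

Lemma ultra_bounded_cvg {R : realType} {T : Type} (F : set_system T)
    (f : T -> R) (K : R) : UltraFilter F -> (forall x, `|f x| <= K) ->
  exists l : R, f @ F --> l.
Proof.
move=> FU fK; have := @segment_compact R (- K) K.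
rewrite compact_ultra => /(_ (f @ F) (ultra_fmap f FU)).
case=> [|l [_ fl]]; last by exists l.
have : F (f @^-1` `[- K, K]).
  by apply: filterS filterT => x _ /=; rewrite in_itv /= -ler_norml.
exact.
Qed.

Lemma ultra_sqnorm_bounded_cvg {R : realType} {T : Type} (F : set_system T)
    (f : T -> R[i]) (K : R) : UltraFilter F -> (forall x, sqnorm (f x) <= K) ->
  exists l, forall e : R, 0 < e -> \forall x \near F, sqnorm (l - f x) < e.
Proof.
move=> FU fK.
have bd (g : R) (x : T) : g ^+ 2 <= sqnorm (f x) -> `|g| <= K + 1.
  move=> gx; rewrite -(@ler_pXn2r _ 2) ?nnegrE//; last first.
    by rewrite addr_ge0// (le_trans _ (fK x)) ?sqnorm_ge0.
  rewrite real_normK ?num_real// (le_trans gx)// (le_trans (fK x))//.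
  have := le_trans (sqnorm_ge0 _) (fK x); nra.
have [a fa] : exists a, (fun x => complex.Re (f x)) @ F --> (a : R).
  apply: (@ultra_bounded_cvg _ _ _ _ (K + 1)) => x; apply: (bd _ x).
  by rewrite sqnormE lerDl sqr_ge0.
have [b fb] : exists b, (fun x => complex.Im (f x)) @ F --> (b : R).
  apply: (@ultra_bounded_cvg _ _ _ _ (K + 1)) => x; apply: (bd _ x).
  by rewrite sqnormE lerDr sqr_ge0.
exists (a +i* b)%C => e e0.
have e1 : 0 < Num.min 1 (e / 2) by rewrite lt_min ltr01 divr_gt0.
move/cvgrPdist_lt: fa => /(_ _ e1) fa; move/cvgrPdist_lt: fb => /(_ _ e1) fb.
have sq (x : R) : `|x| < Num.min 1 (e / 2) -> x ^+ 2 < e / 2.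
  rewrite lt_min => /andP[x1 xe]; rewrite -real_normK ?num_real//.
  by apply: le_lt_trans xe; rewrite expr2 ler_piMr// ltW.
apply: filterS (filterI fa fb) => x [/sq xa /sq xb].
have -> : sqnorm ((a +i* b)%C - f x) =
    (a - complex.Re (f x)) ^+ 2 + (b - complex.Im (f x)) ^+ 2.
  by rewrite sqnormE; case: (f x).
by rewrite [e]splitr ltrD.
Qed.

(** A filter finer than the cofinite one contains no finite set, so that indices
    along it can be chosen arbitrarily large. *)
Lemma ultra_cvg_subsequence {R : realType} {V : normedModType R[i]}
    (F : set_system nat) (u : nat -> V) (l : V) :
  ProperFilter F -> \oo `<=` F -> u @ F --> l ->
  exists2 phi : nat -> nat, {homo phi : i j / (i < j)%N} &
    u (phi j) @[j --> \oo] --> l.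
Proof.
move=> FP ooF /cvg_rnormP ul.
have next (k N : nat) : exists M, (N < M)%N /\ rnorm (l - u M) < k.+1%:R^-1.
  have k0 : (0 : R) < k.+1%:R^-1 by rewrite invr_gt0.
  have oN : F [set M | (N < M)%N] by apply: ooF; exact: nbhs_infty_gt.
  by have [M [NM Ml]] := filter_ex (filterI oN (ul _ k0)); exists M.
pose g k N := projT1 (cid (next k N)).
have gN k N : (N < g k N)%N by rewrite /g; case: cid => M [].
have gl k N : rnorm (l - u (g k N)) < k.+1%:R^-1.
  by rewrite /g; case: cid => M [].
pose phi := fix phi k := if k is k'.+1 then g k (phi k') else g 0%N 0%N.
exists phi; first by apply: homo_ltn => [|i]; [exact: ltn_trans|exact: gN].
apply/cvg_rnormP => e e0.
have : \forall k \near \oo, (k.+1%:R^-1 : R) < e.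
  exact: near_infty_natSinv_lt (PosNum e0).
apply: filterS => k; apply: lt_trans.
by case: k => [|k]; exact: gl.
Qed.

(** A family bounded for the norm of order [s] is Cauchy, for the norm of order
    [t < s], along any ultrafilter. *)
Lemma sobolev_ultra_cauchy {R : realType} {n r : nat} {T : Type}
    (F : set_system T) (c : T -> 'I_r -> 'rV[int]_n -> R[i]) (s t K eps : R) :
  UltraFilter F -> t < s -> 0 <= K -> 0 < eps ->
  (forall x j, sobolev_sum s (c x j) <= K%:E)%E ->
  exists x0, \forall x \near F,
    (\sum_(j < r) sobolev_sum t (fun m => c x0 j m - c x j m)%R <= eps%:E)%E.
Proof.
move=> FU ts K0 eps0 cK.
(* [X] and [del] are chosen so that the low and the high frequencies contribute
   at most [eps / 2] each, and [L] so that [L^(t-s) = 1/X]. *)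
pose X := 1 + r%:R * (4 * K) * 2 / eps.
have X1 : 1 <= X by rewrite lerDl divr_ge0 ?(ltW eps0)// !mulr_ge0.
have X0 : 0 < X by exact: lt_le_trans X1.
pose L := X `^ (s - t)^-1.
have L0 : 0 < L by rewrite powR_gt0.
have LX : L `^ (t - s) = X^-1.
  rewrite /L -powRrM -[t - s]opprB mulrN mulVf ?gt_eqF ?subr_gt0//.
  by rewrite powRN powRr1 ?ltW.
set S := [set m : 'rV[int]_n | sobolev_weight R m <= L].
have finS : finite_set S := finite_sobolev_weight_le L.
set N := (#|` fset_set S|)%fset.
pose del := eps / (2 * (r%:R * N%:R + 1)).
have rN0 : 0 < r%:R * N%:R + 1 :> R by rewrite ltr_wpDl ?mulr_ge0.
have del0 : 0 < del by rewrite divr_gt0 ?mulr_gt0.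
have lim j m : exists l, forall e : R, 0 < e ->
    \forall x \near F, sqnorm (l - c x j m) < e.
  apply: (@ultra_sqnorm_bounded_cvg _ _ _ _ (K / sobolev_weight R m `^ s)) => x.
  rewrite ler_pdivlMr ?sobolev_weight_powR_gt0// mulrC -lee_fin.
  exact: le_trans (sobolev_term_le _ _ _) (cK x j).
pose l j m := projT1 (cid (lim j m)).
have cl j m (e : R) : 0 < e -> \forall x \near F, sqnorm (l j m - c x j m) < e.
  by rewrite /l; case: cid => z; exact.
have unif : \forall x \near F, forall j, forall m : fset_set S,
    sqnorm (l j (val m) - c x j (val m)) <
      del / (4 * sobolev_weight R (val m) `^ t).
  apply: filter_forall => j; apply: filter_forall => m; apply: cl.
  by rewrite divr_gt0// mulr_gt0// sobolev_weight_powR_gt0.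
have [x0 ux0] := filter_ex unif.
exists x0; apply: filterS unif => x ux.
apply: (@le_trans _ _ (\sum_(j < r) (del * N%:R + 4 * K * L `^ (t - s))%:E)%E).
  apply: lee_sum => j _.
  apply: sobolev_sum_tail ts L0 (ltW del0) _ (cK x0 j) (cK x j).
  move=> m mL.
  have mS : m \in fset_set S by rewrite in_fset_set//; exact: mem_set.
  have w0 := sobolev_weight_powR_gt0 m t.
  have := ux0 j [` mS]%fset; rewrite /= ltr_pdivlMr ?mulr_gt0// => ux1.
  have := ux j [` mS]%fset; rewrite /= ltr_pdivlMr ?mulr_gt0// => ux2.
  have := sqnormD_le (l j m - c x j m) (- (l j m - c x0 j m)).
  rewrite sqnormN.
  have -> : l j m - c x j m - (l j m - c x0 j m) = c x0 j m - c x j m.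
    by rewrite opprB addrC addrA subrK.
  move=> le2; apply: le_trans (ler_wpM2l (ltW w0) le2) _; lra.
rewrite sumEFin lee_fin sumr_const card_ord LX -[leLHS]mulr_natl mulrDr.
rewrite [eps]splitr lerD//.
  have <- : del * (r%:R * N%:R + 1) = eps / 2.
    by rewrite /del; field; rewrite gt_eqF.
  by rewrite mulrCA ler_pM2l// lerDl.
rewrite mulrA ler_pdivrMr//.
have -> : eps / 2 * X = eps / 2 + r%:R * (4 * K).
  by rewrite /X; field; rewrite gt_eqF.
by rewrite lerDr divr_ge0// ltW.
Qed.


Theorem theorem1p7 (R : realType) (n : nat) (n_gt0 : (0 < n)%N)
    (theta : 'M[R]_n) (theta_gen : generic_skew theta)
    (A : cstarAlgType R) (U : 'I_n -> A) (A_univ : universal_torus theta U)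
    (alpha : 'rV[R]_n -> {lrmorphism A -> A}) (alphaP : torus_action U alpha)
    (r : nat) (e : 'M[A]_r) (eP : smooth_projection alpha e)
    (s t : R) (lt_ts : t < s)
    (Ht : completeNormedModType R[i]) (iota : 'cV[A]_r -> Ht)
    (HtP : sobolev_completion U (range_module alpha e) t iota)
    (a : nat -> 'cV[A]_r) (aE : forall N, range_module alpha e (a N))
    (C : R) (aC : forall N, (sobolev_norm U s (a N) <= C%:E)%E) :
  exists2 phi : nat -> nat, {homo phi : i j / (i < j)%N} &
    exists h : Ht, iota (a (phi j)) @[j --> \oo] --> h.
Proof.
have unitaryU : forall j, unitary (U j) by case: A_univ => -[].
have [F [FU ooF]] := @ultraFilterLemma nat \oo _.
have FP : ProperFilter F by exact: ultra_proper.
have acvg : cvg ((iota \o a) @ F).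
  apply: cauchy_cvg; apply: cauchy_exP => eps eps0.
  have epsR : eps = ((complex.Re eps)%:C)%C by rewrite RRe_real// gtr0_real.
  move: eps0; rewrite epsR ltcR; set d := complex.Re eps => d0.
  have d2 : 0 < d ^+ 2 / 2 by rewrite divr_gt0 ?exprn_gt0.
  have [N0 FN0] := sobolev_ultra_cauchy FU lt_ts (sqr_ge0 C) d2
    (fun N j => sobolev_norm_le j (aC N)).
  exists (iota (a N0)); apply: filterS FN0 => N aN /=.
  rewrite -ball_normE /= -rnormE ltcR.
  rewrite -(@ltr_pXn2r _ 2) ?nnegrE ?rnorm_ge0 ?ltW// -lte_fin.
  apply: le_lt_trans (rnorm_iota_sub_sqr unitaryU alphaP HtP (aE N0) (aE N)) _.
  apply: le_lt_trans aN _; rewrite lte_fin.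
  by rewrite ltr_pdivrMr// mulr_natr mulr2n ltrDl exprn_gt0.
have /cvg_ex[h ah] := acvg.
have [phi phiM phih] := ultra_cvg_subsequence FP ooF ah.
by exists phi; last exists h.
Qed.
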